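(* For all cardinal numbers $\kappa$, the following is a fibration (a locally trivial fibre bundle with total space $O(\kappa)$, base $S^\kappa$ and fibre $O^{(1)}(\kappa)$): $$O^{(1)}(\kappa)\longrightarrow O(\kappa)\xrightarrow{\ \tilde{\pi}\ }S^{\kappa}.$$ Here $\pi:O(\kappa)\to O(\kappa)/O^{(1)}(\kappa)$ is the canonical projection induced by the quotient, $\sigma$ is the homeomorphism $O(\kappa)/O^{(1)}(\kappa)\to S^\kappa$, and the fibre projection is defined as $\tilde\pi=\sigma\circ\pi$.
   Context: For a cardinal number $\kappa$, let $\mathcal{H}$ be a real Hilbert space of Hilbert dimension $\kappa$. $O(\kappa)=\mathrm{Aut}(\mathcal{H})$ is the group, under composition, of all bijective linear inner-product-preserving maps $\mathcal{H}\to\mathcal{H}$, with the topology induced by the operator norm. Fix an orthonormal basis of $\mathcal{H}$ with first elements $e_0,e_1,\dots$. $O^{(1)}(\kappa)\subseteq O(\kappa)$ is the subgroup of operators keeping $\mathrm{span}\{e_0\}$ fixed (pointwise, i.e. the stabilizer of $e_0$), with the subspace topology; the map $O^{(1)}(\kappa)\to O(\kappa)$ is the inclusion. It acts on $O(\kappa)$ on the right by multiplication, and $O(\kappa)/O^{(1)}(\kappa)$ is the orbit space (space of cosets $AO^{(1)}(\kappa)$) with the quotient topology. $S^\kappa$ denotes the unit sphere, with the norm topology, of a real Hilbert space of Hilbert dimension $|\kappa+1|$; for infinite $\kappa$ this is the unit sphere $\{x\in\mathcal{H}:\|x\|=1\}$, and $\sigma$ is then the map induced by $A\mapsto Ae_0$.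 A locally trivial fibre bundle here means: every point of $S^\kappa$ has an open neighbourhood $\mathcal{N}$ and a homeomorphism $\varphi:\tilde\pi^{-1}(\mathcal{N})\to\mathcal{N}\times O^{(1)}(\kappa)$ with $\mathrm{proj}_1\circ\varphi=\tilde\pi$ on $\tilde\pi^{-1}(\mathcal{N})$, where $\mathrm{proj}_1$ is the projection to the first factor.
   Formalization: For finite κ the claim fails as written (κ=1: the quotient has two points, S^1 is a circle) and for κ=0 there is no e_0; the formal version takes κ≥1 and uses as base the unit sphere of the space of dimension κ itself, which is S^κ for infinite κ. *)

(* Defs.v *)
From HB Require Import structures.
From mathcomp Require Import all_boot all_order all_algebra.
From mathcomp Require Import all_classical all_reals all_analysis.

Set Implicit Arguments.
Unset Strict Implicit.
Unset Printing Implicit Defensive.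

Import Order.TTheory GRing.Theory Num.Theory.
Import numFieldNormedType.Exports.

Local Open Scope classical_set_scope.
Local Open Scope ring_scope.
Local Open Scope quotient_scope.

HB.mixin Record isHilbert (R : realType) H & CompleteNormedModule R H := {
  dotp : {dot H for (@idfun R)} ;
  dotp_norm : forall x : H, `|x| ^+ 2 = dotp x x
}.

#[short(type="hilbertType")]
HB.structure Definition Hilbert (R : realType) :=
  { H of CompleteNormedModule R H & isHilbert R H }.

Section hilbert_basis.
Context {R : realType} {H : hilbertType R}.

(* This is S^kappa when H has infinite Hilbert dimension kappa = kappa + 1, and
   S^(n-1) when H has finite dimension n. *)
Definition unit_sphere : set H := [set x | `|x| = 1].

(* A space with a Hilbert basis indexed by I has Hilbert dimension |I|; I is an
   arbitrary type, so every cardinal occurs as a dimension. *)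
Definition hilbert_basis (I : Type) (e : I -> H) : Prop :=
  (forall i j, dotp (e i) (e j) = `[< i = j >]%:R) /\
  closure [set \sum_(p <- s) p.1 *: e p.2 | s in [set: seq (R * I)]] = setT.

Lemma hilbert_basis_unit (I : Type) (e : I -> H) (i : I) :
  hilbert_basis e -> e i \in unit_sphere.
Proof.
move=> [orth _]; rewrite inE /unit_sphere /=; apply/eqP.
have ei1 : `|e i| ^+ 2 = 1 by rewrite dotp_norm orth asboolT.
by rewrite -(@eqrXn2 _ 2) ?expr1n ?ei1.
Qed.

Definition basis_point (I : Type) (e : I -> H) (he : hilbert_basis e) (i : I) :
  unit_sphere := exist _ (e i) (hilbert_basis_unit i he).

End hilbert_basis.
Arguments unit_sphere {R} H.

Record orthop (R : realType) (H : hilbertType R) := Orthop {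
  orthop_fun :> H -> H ;
  orthop_linear : linear orthop_fun ;
  orthop_bij : bijective orthop_fun ;
  orthop_dotp : forall x y,
    dotp (orthop_fun x) (orthop_fun y) = dotp x y
}.
Arguments orthop {R} H.
Arguments Orthop {R H}.

HB.instance Definition _ (R : realType) (H : hilbertType R) :=
  gen_eqMixin (orthop H).
HB.instance Definition _ (R : realType) (H : hilbertType R) :=
  gen_choiceMixin (orthop H).

HB.instance Definition _ (R : realType) (H : hilbertType R) (A : orthop H) :=
  @GRing.isLinear.Build R H H _ (orthop_fun A) (orthop_linear A).

Section orthop_group.
Context {R : realType} {H : hilbertType R}.
Implicit Types A B C : orthop H.

Lemma orthop_eq A B : orthop_fun A = orthop_fun B -> A = B.
Proof.
case: A B => [f lf bf df] [g lg bg dg] /= fg.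
by subst g; congr Orthop; exact: Prop_irrelevance.
Qed.

Lemma orthop_norm A x : `|A x| = `|x|.
Proof.
by apply/eqP; rewrite -(@eqrXn2 _ 2)// !dotp_norm orthop_dotp.
Qed.

Definition orthop1 : orthop H.
Proof. by refine (Orthop idfun _ _ _) => //; exists idfun. Defined.

Definition orthop_mul A B : orthop H.
Proof.
refine (Orthop (A \o B) _ _ _).
- by move=> a x y /=; rewrite !linearP.
- exact: bij_comp (orthop_bij A) (orthop_bij B).
- by move=> x y /=; rewrite !orthop_dotp.
Defined.

Definition orthop_inv_fun A : H -> H :=
  projT1 (cid (let: Bijective g fK gK := orthop_bij A in
               ex_intro (fun g => cancel A g /\ cancel g A) g (conj fK gK))).

Lemma orthop_inv_funK A : cancel A (orthop_inv_fun A).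
Proof. by rewrite /orthop_inv_fun; case: cid => g []. Qed.

Lemma orthop_fun_invK A : cancel (orthop_inv_fun A) A.
Proof. by rewrite /orthop_inv_fun; case: cid => g []. Qed.

Definition orthop_inv A : orthop H.
Proof.
refine (Orthop (orthop_inv_fun A) _ _ _).
- move=> a x y; apply: (can_inj (orthop_inv_funK A)).
  by rewrite [RHS]linearP /= !orthop_fun_invK.
- exact: (Bijective (orthop_fun_invK A) (orthop_inv_funK A)).
- by move=> x y; rewrite -(orthop_dotp A) !orthop_fun_invK.
Defined.

Lemma orthop_mulA : associative orthop_mul.
Proof. by move=> A B C; exact: orthop_eq. Qed.

Lemma orthop_1mul : left_id orthop1 orthop_mul.
Proof. by move=> A; exact: orthop_eq. Qed.

Lemma orthop_mul1 : right_id orthop1 orthop_mul.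
Proof. by move=> A; exact: orthop_eq. Qed.

Lemma orthop_Vmul : left_inverse orthop1 orthop_inv orthop_mul.
Proof. by move=> A; apply/orthop_eq/funext => x /=; exact: orthop_inv_funK. Qed.

Lemma orthop_mulV : right_inverse orthop1 orthop_inv orthop_mul.
Proof. by move=> A; apply/orthop_eq/funext => x /=; exact: orthop_fun_invK. Qed.

End orthop_group.

HB.instance Definition _ (R : realType) (H : hilbertType R) :=
  isGroup.Build (orthop H)
    orthop_mulA orthop_1mul orthop_mul1 orthop_Vmul orthop_mulV.

Section opnorm.
Context {R : realType} {H : hilbertType R}.

(* sup of an unbounded set is 0, so this is the operator norm only for bounded
   T; it is used for differences of orthogonal operators. *)
Definition opnorm (T : H -> H) : R := sup [set `|T x| | x in [set x | `|x| <= 1]].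

Definition orthop_dist (A B : orthop H) : R := opnorm (fun x => A x - B x).

Lemma orthop_dist_nonempty (A B : orthop H) :
  [set `|A x - B x| | x in [set x | `|x| <= 1]] !=set0.
Proof. by exists `|A 0 - B 0|, 0 => //=; rewrite normr0. Qed.

Lemma orthop_dist_le (A B : orthop H) (x : H) :
  `|x| <= 1 -> `|A x - B x| <= orthop_dist A B.
Proof.
move=> x1; apply: ub_le_sup; last by exists x.
exists 2 => _ [y /= y1 <-].
by rewrite (le_trans (ler_normB _ _))// !orthop_norm -[2]/(1 + 1) lerD.
Qed.

Lemma orthop_distxx (A : orthop H) : orthop_dist A A = 0.
Proof.
apply/eqP; rewrite eq_le; apply/andP; split.
  apply: ge_sup; first exact: orthop_dist_nonempty.
  by move=> _ [x _ <-]; rewrite subrr normr0.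
have /(orthop_dist_le A A) : `|0 : H| <= 1 by rewrite normr0.
exact: le_trans.
Qed.

Lemma orthop_dist_positivity (A B : orthop H) : orthop_dist A B = 0 -> A = B.
Proof.
move=> AB; apply/orthop_eq/funext => x; have [->|x0] := eqVneq x 0.
  by rewrite !linear0.
have nx0 : `|x| != 0 by rewrite normr_eq0.
have /(orthop_dist_le A B) : `| `|x|^-1 *: x | <= 1.
  by rewrite normrZ normfV normr_id mulVf.
rewrite AB normr_le0 subr_eq0 !linearZ /= => /eqP /(congr1 ( *:%R `|x|)).
by rewrite !scalerA mulfV// !scale1r.
Qed.

Lemma orthop_dist_sym (A B : orthop H) : orthop_dist A B = orthop_dist B A.
Proof.
rewrite /orthop_dist /opnorm; congr sup.
by apply/seteqP; split=> _ [x x1 <-]; exists x => //; rewrite distrC.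
Qed.

Lemma orthop_dist_triangle (B A C : orthop H) :
  orthop_dist A C <= orthop_dist A B + orthop_dist B C.
Proof.
apply: ge_sup; first exact: orthop_dist_nonempty.
move=> _ [x x1 <-]; rewrite (le_trans (ler_distD (B x) _ _))//.
by rewrite lerD// orthop_dist_le.
Qed.

End opnorm.

HB.instance Definition _ (R : realType) (H : hilbertType R) :=
  @isMetric.Build R (orthop H) orthop_dist orthop_distxx orthop_dist_positivity
    orthop_dist_sym orthop_dist_triangle.

Section orbit_space.
Context {R : realType} {H : hilbertType R} (e0 : unit_sphere H).
Implicit Types A B C : orthop H.

Definition orthop_stab : set (orthop H) :=
  [set A | A (\val e0) = \val e0].

Lemma orthop_stab1 : orthop_stab 1%g.
Proof. by []. Qed.

Lemma orthop_stabM A B : orthop_stab A -> orthop_stab B -> orthop_stab (A * B)%g.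
Proof.
move=> Ae Be; change (A (B (\val e0)) = \val e0); rewrite Be; exact: Ae.
Qed.

Lemma orthop_stabV A : orthop_stab A -> orthop_stab (A^-1)%g.
Proof.
move=> Ae; change (orthop_inv_fun A (\val e0) = \val e0).
by rewrite -{1}Ae orthop_inv_funK.
Qed.

Definition orthop_orbit_rel A B : bool :=
  `[< exists2 C, orthop_stab C & B = (A * C)%g >].

Lemma orthop_orbit_equiv : equiv_class_of orthop_orbit_rel.
Proof.
split=> [A|A B|B A C].
- by apply/asboolP; exists 1%g; [exact: orthop_stab1|rewrite mulg1].
- by apply/asboolP/asboolP => -[C /orthop_stabV Ce ->];
    exists (C^-1)%g => //; rewrite mulgK.
- move=> /asboolP[D De ->] /asboolP[E Ee ->]; apply/asboolP.
  by exists (D * E)%g; [exact: orthop_stabM|rewrite mulgA].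
Qed.

Canonical orthop_orbit_equiv_rel := EquivRelPack orthop_orbit_equiv.

Definition orthop_orbit_space : topologicalType :=
  quotient_topology {eq_quot orthop_orbit_rel}.

Definition orbit_proj (A : orthop H) : orthop_orbit_space :=
  \pi_({eq_quot orthop_orbit_rel}) A.

Lemma orthop_unit_sphere A (x : unit_sphere H) :
  A (\val x) \in unit_sphere H.
Proof. by rewrite inE /unit_sphere /= orthop_norm; case: x => x /= /[!inE]. Qed.

Definition orthop_eval A : unit_sphere H :=
  exist _ (A (\val e0)) (orthop_unit_sphere A e0).

Definition orbit_eval (q : orthop_orbit_space) : unit_sphere H :=
  orthop_eval (repr (q : {eq_quot orthop_orbit_rel})).

Lemma orbit_evalE A : orbit_eval (orbit_proj A) = orthop_eval A.
Proof.
apply: val_inj => /=; rewrite /orbit_proj.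
case: piP => B /eqmodP/asboolP[C Ce ->].
by change (A (C (\val e0)) = A (\val e0)); rewrite Ce.
Qed.

Definition sphere_proj : orthop H -> unit_sphere H := orbit_eval \o orbit_proj.

End orbit_space.

Arguments orbit_proj {R H} e0 A.
Arguments orbit_eval {R H} e0 q.

Definition homeomorphism (X Y : topologicalType) (f : X -> Y) : Prop :=
  continuous f /\
  exists g : Y -> X, [/\ continuous g, cancel f g & cancel g f].

Definition locally_trivial_bundle (F E B : topologicalType) (p : E -> B) : Prop :=
  forall b : B, exists N : set B, [/\ open N, N b &
    exists phi : (p @^-1` N) -> (N * F)%type,
      homeomorphism phi /\ forall x, \val (phi x).1 = p (\val x)].

(* Main.v *)
Require Import Defs.
From mathcomp Require Import all_boot all_order all_algebra.
From mathcomp Require Import all_classical all_reals all_analysis.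
From mathcomp Require Import ring lra.

(** The evaluation map [A |-> A e0] from the orthogonal group to the unit sphere
admits a continuous section near every point, and this gives everything.

The sections come from half-turns. For a nonzero vector [v], let [halfturn v]
fix the line spanned by [v] and act as [-1] on its orthogonal complement, so that it
sends [z] to [2 <z, h> h - z] with [h = v / |v|]. It is an orthogonal
involution, and for unit vectors [x] and [y] the half-turn about [x + y]
exchanges [x] and [y]. Since [0^-1 = 0], the half-turn about [0] is [-1], which
still exchanges [x] and [y] when [x = -y]; hence the formula needs no case
distinction ([halfturn_add]). By Cauchy-Schwarz the operator [halfturn v] is a
Lipschitz function of [h] for the operator norm, so [halfturn] is continuous
away from [0] ([continuous_halfturn]).

For [b] in the sphere, [rotation_from b x] is the half-turn about [b + e0]
followed by the half-turn about [x + b]. It sends [e0] to [b] and then to [x],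
so it is a section on the whole sphere ([rotation_fromK]), and it is continuous
at every [x] other than [-b] ([continuous_rotation_from]).

Because the orbits of the stabilizer of [e0] are exactly the fibres of the
evaluation, a section composed with the orbit projection is the inverse of the
induced map from the orbit space to the sphere. That inverse is the same for all
[b], so it is continuous at [x] by taking [b = x], and the induced map is a
homeomorphism ([orbit_eval_homeomorphism]). Over the complement [N] of [-b], a
section [s] that is continuous on [N] trivializes the evaluation by
[A |-> (p A, s (p A)^-1 A)], where [p A = A e0], with inverse
[(x, B) |-> s x B]; both are continuous because the orthogonal group is a
topological group for the operator norm
([trivialization_homeomorphism], [sphere_proj_locally_trivial]). *)

Local Open Scope classical_set_scope.
Local Open Scope ring_scope.

Import Order.TTheory GRing.Theory Num.Theory.
Import numFieldNormedType.Exports.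

(** * The Cauchy-Schwarz inequality *)

Section inner_product.
Context {R : realType} {H : hilbertType R}.
Implicit Types (x y z v w : H) (a : R).

Lemma dotpC x y : dotp x y = dotp y x.
Proof. by rewrite hermC /= mul1r. Qed.

Lemma dotpDl x y z : dotp (x + y) z = dotp x z + dotp y z.
Proof. exact: linearDl. Qed.

Lemma dotpZl a x z : dotp (a *: x) z = a * dotp x z.
Proof. exact: linearZl_LR. Qed.

Lemma dotpDr x y z : dotp z (x + y) = dotp z x + dotp z y.
Proof. by rewrite dotpC dotpDl !(dotpC _ z). Qed.

Lemma dotpZr a x z : dotp z (a *: x) = a * dotp z x.
Proof. by rewrite dotpC dotpZl (dotpC _ z). Qed.

Lemma dotpNl x z : dotp (- x) z = - dotp x z.
Proof. by rewrite -scaleN1r dotpZl mulN1r. Qed.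

Lemma dotpNr x z : dotp z (- x) = - dotp z x.
Proof. by rewrite dotpC dotpNl (dotpC _ z). Qed.

Definition dotpE := (dotpDl, dotpDr, dotpNl, dotpNr, dotpZl, dotpZr).

(** The triangle inequality for the norm, squared and expanded. *)
Lemma ler_dotp x y : dotp x y <= `|x| * `|y|.
Proof.
have : `|x + y| ^+ 2 <= (`|x| + `|y|) ^+ 2.
  by rewrite ler_pXn2r ?nnegrE ?addr_ge0// ler_normD.
by rewrite sqrrD !dotp_norm !dotpE (dotpC y x); lra.
Qed.

Lemma cauchy_schwarz x y : `|dotp x y| <= `|x| * `|y|.
Proof.
rewrite ler_norml ler_dotp andbT lerNl -dotpNl.
by rewrite (le_trans (ler_dotp _ _))// normrN.
Qed.

End inner_product.

(** * Continuity into subspaces and products *)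

Lemma continuous_set_type (X Y : topologicalType) (S : set Y) (f : X -> S) x :
  {for x, continuous (fun y => \val (f y))} -> {for x, continuous f}.
Proof.
move=> cf U [_ [[V oV <-] Vfx] VU]; apply: filterS VU _; apply: cf.
exact: open_nbhs_nbhs.
Qed.

Lemma continuous_set_val (Y : topologicalType) (S : set Y) :
  continuous (fun y : S => \val y).
Proof. exact: initial_continuous. Qed.

Lemma continuous_pair (X Y Z : topologicalType) (f : X -> Y) (g : X -> Z) x :
  {for x, continuous f} -> {for x, continuous g} ->
  {for x, continuous (fun y => (f y, g y))}.
Proof. by move=> cf cg; exact: cvg_pair. Qed.

(** * Half-turns *)

Section halfturn.
Context {R : realType} {H : hilbertType R}.
Implicit Types (x y z v w : H) (a : R).

Definition normalize v : H := `|v|^-1 *: v.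

Lemma normalize_norm_le1 v : `|normalize v| <= 1.
Proof.
rewrite normrZ normfV normr_id; have [->|v0] := eqVneq v 0.
  by rewrite normr0 mulr0.
by rewrite mulVf// normr_eq0.
Qed.

(** Treats [v = 0] together with [v != 0], so that [halfturn_fun v] is an
orthogonal involution for every [v]: the squared norm of [normalize v] is [1] if
[v != 0], and otherwise both sides vanish. *)
Lemma normalize_dotpK z v :
  dotp z (normalize v) * dotp (normalize v) (normalize v)
  = dotp z (normalize v).
Proof.
rewrite /normalize; have [->|v0] := eqVneq v 0.
  by rewrite scaler0 -(scale0r 0) dotpZr !mul0r.
by rewrite !dotpE -dotp_norm; field; rewrite normr_eq0.
Qed.

Lemma continuous_normalize v : v != 0 -> {for v, continuous normalize}.
Proof.
move=> v0; apply: cvgZ; last exact: cvg_id.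
by apply: cvgV; [rewrite normr_eq0|exact: norm_continuous].
Qed.

Definition halfturn_fun v z : H :=
  (2 * dotp z (normalize v)) *: normalize v - z.

Lemma halfturn_fun_linear v : linear (halfturn_fun v).
Proof.
move=> a x y; rewrite /halfturn_fun; move: (normalize v) => h; rewrite !dotpE.
by rewrite mulrDr scalerDl scalerBr scalerA mulrCA opprD addrACA.
Qed.

Lemma halfturn_funK v : involutive (halfturn_fun v).
Proof.
move=> z; have := normalize_dotpK z v; rewrite /halfturn_fun.
move: (normalize v) => h hK; rewrite !dotpE -mulrA hK opprB addrA.
rewrite (_ : 2 * _ = 2 * dotp z h); last by ring.
by rewrite addrAC subrr add0r.
Qed.

Lemma halfturn_fun_dotp v x y :
  dotp (halfturn_fun v x) (halfturn_fun v y) = dotp x y.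
Proof.
have := normalize_dotpK x v; rewrite /halfturn_fun.
move: (normalize v) => h; rewrite !dotpE (dotpC h y) => hK.
transitivity (4 * dotp y h * (dotp x h * dotp h h)
    - 4 * dotp x h * dotp y h + dotp x y); first by ring.
by rewrite hK; ring.
Qed.

Definition halfturn v : orthop H :=
  Orthop (halfturn_fun v) (halfturn_fun_linear v)
    (inv_bij (@halfturn_funK v)) (halfturn_fun_dotp v).

(** The component of [y] along [x + y] is half of [x + y], because
[|x + y|^2 = 2 + 2 <x, y> = 2 <y, x + y>] for unit vectors. *)
Lemma halfturn_add x y : `|x| = 1 -> `|y| = 1 -> halfturn (x + y) y = x.
Proof.
move=> x1 y1; rewrite /= /halfturn_fun /normalize.
have [xy0|xy0] := eqVneq (x + y) 0.
  (* The half-turn about 0 is the antipodal map, and here x = - y. *)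
  by rewrite xy0 !scaler0 sub0r; apply/esym/eqP; rewrite -addr_eq0 xy0.
rewrite dotpZr scalerA (_ : _ * _ = 1) ?scale1r ?addrK//.
have nxy : `|x + y| != 0 by rewrite normr_eq0.
have : `|x + y| ^+ 2 = 2 * dotp y (x + y).
  by rewrite dotp_norm !dotpE -!dotp_norm x1 y1 (dotpC x y); ring.
by move=> e; rewrite mulrCA -e; field.
Qed.

(** With [p] and [q] the normalized vectors, both of norm at most [1],
[<z, p> p - <z, q> q = <z, p - q> p + <z, q> (p - q)], and each of the two terms
has norm at most [|z| |p - q|]. *)
Lemma orthop_dist_halfturn v w :
  orthop_dist (halfturn v) (halfturn w) <= 4 * `|normalize v - normalize w|.
Proof.
apply: ge_sup; first exact: orthop_dist_nonempty.
move=> _ [z z1 <-]; rewrite /= /halfturn_fun.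
have := normalize_norm_le1 v; have := normalize_norm_le1 w.
move: (normalize v) (normalize w) => p q q1 p1.
have -> : (2 * dotp z p) *: p - z - ((2 * dotp z q) *: q - z)
    = (2 * dotp z (p - q)) *: p + (2 * dotp z q) *: (p - q).
  by rewrite opprB addrA subrK !dotpE mulrBr scalerBl scalerBr addrA subrK.
rewrite (le_trans (ler_normD _ _))// !normrZ ger0_norm//.
have zq : `|dotp z q| <= 1.
  by rewrite (le_trans (cauchy_schwarz _ _))// -[leRHS]mulr1 ler_pM.
have zpq : `|dotp z (p - q)| <= `|p - q|.
  by rewrite (le_trans (cauchy_schwarz _ _))// ler_piMl.
have := ler_pM (normr_ge0 _) (normr_ge0 _) zpq p1.
have := ler_pM (normr_ge0 _) (normr_ge0 _) zq (lexx `|p - q|).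
lra.
Qed.

Lemma continuous_halfturn v : v != 0 -> {for v, continuous halfturn}.
Proof.
move=> v0; apply/cvg_ballP => eps eps0.
have /cvgrPdist_lt/(_ (eps / 4)) := continuous_normalize v v0.
rewrite divr_gt0// => /(_ isT).
apply: filterS => w vw; rewrite /ball /=.
rewrite (le_lt_trans (orthop_dist_halfturn _ _))//.
by rewrite mulrC -ltr_pdivlMr.
Qed.

End halfturn.

(** * The orthogonal group is a topological group *)

Section orthop_topology.
Context {R : realType} {H : hilbertType R}.
Implicit Types A B C D : orthop H.

(** [AB - CD = (A - C) B + C (B - D)], where [B] and [C] are isometries. *)
Lemma orthop_dist_mul A B C D :
  orthop_dist (A * B)%g (C * D)%g <= orthop_dist A C + orthop_dist B D.
Proof.
apply: ge_sup; first exact: orthop_dist_nonempty.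
move=> _ [x x1 <-].
change (`|A (B x) - C (D x)| <= orthop_dist A C + orthop_dist B D).
have -> : A (B x) - C (D x) = (A (B x) - C (B x)) + C (B x - D x).
  by rewrite linearB/= addrA subrK.
rewrite (le_trans (ler_normD _ _))// orthop_norm lerD ?orthop_dist_le//.
by rewrite orthop_norm.
Qed.

(** [A^-1 - B^-1 = A^-1 (B - A) B^-1], with isometries as outer factors. *)
Lemma orthop_dist_inv A B : orthop_dist A^-1%g B^-1%g <= orthop_dist A B.
Proof.
apply: ge_sup; first exact: orthop_dist_nonempty.
move=> _ [x x1 <-].
change (`|orthop_inv_fun A x - orthop_inv_fun B x| <= orthop_dist A B).
rewrite -(orthop_norm A) linearB/= orthop_fun_invK.
rewrite -[X in X - _](orthop_fun_invK B) distrC orthop_dist_le//.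
by rewrite -(orthop_norm B) orthop_fun_invK.
Qed.

Lemma continuous_orthop_mul (X : topologicalType) (f g : X -> orthop H) x :
  {for x, continuous f} -> {for x, continuous g} ->
  {for x, continuous (fun y => f y * g y)%g}.
Proof.
move=> /cvg_ballP cf /cvg_ballP cg; apply/cvg_ballP => eps eps0.
have eps2 : 0 < eps / 2 by rewrite divr_gt0.
apply: filterS2 (cf _ eps2) (cg _ eps2) => y; rewrite /ball /= => fy gy.
by rewrite (le_lt_trans (orthop_dist_mul _ _ _ _))// (splitr eps) ltrD.
Qed.

Lemma continuous_orthop_inv (X : topologicalType) (f : X -> orthop H) x :
  {for x, continuous f} -> {for x, continuous (fun y => (f y)^-1)%g}.
Proof.
move=> /cvg_ballP cf; apply/cvg_ballP => eps eps0.
apply: filterS (cf _ eps0) => y; rewrite /ball /=.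
exact/le_lt_trans/orthop_dist_inv.
Qed.

End orthop_topology.

(** * Evaluation at a unit vector and its sections *)

Section evaluation.
Context {R : realType} {H : hilbertType R} (e0 : unit_sphere H).
Implicit Types (A B : orthop H) (x b : unit_sphere H).

Lemma unit_sphere_norm x : `|\val x| = 1.
Proof. exact: set_valP x. Qed.

Lemma sphere_projE A : \val (sphere_proj e0 A) = A (\val e0).
Proof. exact: congr1 (orbit_evalE e0 A). Qed.

Lemma sphere_projM_stab A B :
  orthop_stab e0 B -> sphere_proj e0 (A * B)%g = sphere_proj e0 A.
Proof.
move=> Be; apply: val_inj; rewrite !sphere_projE.
by change (A (B (\val e0)) = A (\val e0)); rewrite Be.
Qed.

(** If [A e0 = B e0], then [A^-1 B] fixes [e0]: the fibres of the evaluation are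
the orbits. *)
Lemma orbit_proj_eq A B :
  sphere_proj e0 A = sphere_proj e0 B -> orbit_proj e0 A = orbit_proj e0 B.
Proof.
move=> /(congr1 \val); rewrite !sphere_projE => AB; apply/eqmodP/asboolP.
exists (A^-1 * B)%g; last by rewrite mulVKg.
change (orthop_inv_fun A (B (\val e0)) = \val e0).
by rewrite -AB orthop_inv_funK.
Qed.

Lemma continuous_sphere_proj : continuous (sphere_proj e0).
Proof.
move=> A; apply: continuous_set_type.
apply/(@cvgrPdist_lt _ _ _ (nbhs A) (nbhs_filter A)) => eps eps0.
have := nbhsx_ballx A _ eps0; apply: filterS => B.
rewrite !sphere_projE; apply: le_lt_trans.
by rewrite orthop_dist_le// unit_sphere_norm.
Qed.

(** The only possible discontinuity, at [- b], moves with the base point [b], so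
every point of the sphere has a section that is continuous around it. *)
Definition rotation_from b x : orthop H :=
  (halfturn (\val x + \val b) * halfturn (\val b + \val e0))%g.

Lemma rotation_fromK b : cancel (rotation_from b) (sphere_proj e0).
Proof.
move=> x; apply: val_inj; rewrite sphere_projE.
change (halfturn (\val x + \val b) (halfturn (\val b + \val e0) (\val e0))
  = \val x).
by rewrite !halfturn_add ?unit_sphere_norm.
Qed.

Lemma continuous_addr_point (v : H) :
  continuous (fun x : unit_sphere H => \val x + v).
Proof.
move=> x; apply: (@continuousD _ _ _ (fun x : unit_sphere H => \val x)).
  exact: continuous_set_val.
exact: cst_continuous.
Qed.

Lemma continuous_rotation_from b x :
  \val x + \val b != 0 -> {for x, continuous (rotation_from b)}.
Proof.
move=> xb0; apply: continuous_orthop_mul; last exact: cst_continuous.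
apply: (@continuous_comp _ _ _ (fun x => \val x + \val b) halfturn).
  exact: continuous_addr_point.
exact: continuous_halfturn.
Qed.

Lemma unit_sphere_addxx b : \val b + \val b != 0.
Proof.
rewrite -mulr2n -scaler_nat scaler_eq0 pnatr_eq0 /= -normr_eq0.
by rewrite unit_sphere_norm oner_eq0.
Qed.

(** [rotation_from x] may replace [rotation_from e0] in the inverse when
continuity at [x] is at stake, because their values lie in the same orbits. *)
Lemma orbit_eval_homeomorphism : homeomorphism (orbit_eval e0).
Proof.
split; first by apply/quotient_continuous; exact: continuous_sphere_proj.
exists (fun x => orbit_proj e0 (rotation_from e0 x)); split.
- move=> x; rewrite (_ : (fun _ => _) = orbit_proj e0 \o rotation_from x).
    apply: continuous_comp; last exact: pi_continuous.
    exact/continuous_rotation_from/unit_sphere_addxx.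
  by apply/funext => y; apply: orbit_proj_eq; rewrite !rotation_fromK.
- move=> q; rewrite -[in RHS](reprK q).
  by apply: orbit_proj_eq; rewrite rotation_fromK -[in LHS](reprK q).
- exact: rotation_fromK.
Qed.

Lemma range_orthop_stab :
  range (set_val : orthop_stab e0 -> orthop H)
    = sphere_proj e0 @^-1` [set e0].
Proof.
apply/seteqP; split=> [_ [[A AF] _ <-]|A /= Ae].
  by apply: val_inj; rewrite sphere_projE; exact: (set_mem AF).
have Ae' : A \in orthop_stab e0.
  by rewrite inE /orthop_stab /= -sphere_projE Ae.
by exists (exist _ A Ae').
Qed.

(** * The trivialization given by a section *)

Section trivialization.
Context (N : set (unit_sphere H)) (s : unit_sphere H -> orthop H)
  (sK : cancel s (sphere_proj e0))
  (s_continuous : forall x, N x -> {for x, continuous s}).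

Let E := sphere_proj e0 @^-1` N.
Let F := orthop_stab e0.

Lemma trivialization_base_subproof (A : E) : sphere_proj e0 (\val A) \in N.
Proof. exact: mem_set (set_valP A). Qed.

Lemma trivialization_fibre_subproof (A : E) :
  ((s (sphere_proj e0 (\val A)))^-1 * \val A)%g \in F.
Proof.
rewrite inE /F /orthop_stab /=; set A' := \val A.
change (orthop_inv_fun (s (sphere_proj e0 A')) (A' (\val e0)) = \val e0).
rewrite -sphere_projE -{2}(sK (sphere_proj e0 A')) sphere_projE.
exact: orthop_inv_funK.
Qed.

(** [A] and [s (p A)] agree at [e0], where [p] is the evaluation, so they differ
by an element of the stabilizer. *)
Definition trivialization (A : E) : N * F :=
  (exist (fun y => y \in N) _ (trivialization_base_subproof A),
   exist (fun y => y \in F) _ (trivialization_fibre_subproof A)).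

Lemma trivialization_inv_subproof (xB : N * F) :
  (s (\val xB.1) * \val xB.2)%g \in E.
Proof. rewrite inE /E /= sphere_projM_stab ?sK; exact: set_valP. Qed.

Definition trivialization_inv (xB : N * F) : E :=
  exist (fun y => y \in E) _ (trivialization_inv_subproof xB).

Lemma trivialization_homeomorphism : homeomorphism trivialization.
Proof.
have p_continuous : continuous (fun A : E => sphere_proj e0 (\val A)).
  move=> A; apply: (@continuous_comp _ _ _ (fun A : E => \val A)).
    exact: continuous_set_val.
  exact: continuous_sphere_proj.
have base_continuous : continuous (fun A : E => (trivialization A).1).
  by move=> A; apply: continuous_set_type; exact: p_continuous.
have fibre_continuous : continuous (fun A : E => (trivialization A).2).
  move=> A; apply: continuous_set_type; apply: continuous_orthop_mul.
    apply: continuous_orthop_inv.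
    apply: (@continuous_comp _ _ _ _ s); first exact: p_continuous.
    by apply: s_continuous; exact: (set_valP (trivialization A).1).
  exact: continuous_set_val.
split=> [A|].
  exact: (continuous_pair _ _ _ _ _ A (base_continuous A) (fibre_continuous A)).
exists trivialization_inv; split.
- move=> xB; apply: continuous_set_type; apply: continuous_orthop_mul.
    apply: (@continuous_comp _ _ _ (fun xB : N * F => \val xB.1) s).
      apply: (@continuous_comp _ _ _ fst); first exact: cvg_fst.
      exact: continuous_set_val.
    by apply: s_continuous; exact: set_valP.
  apply: (@continuous_comp _ _ _ snd); first exact: cvg_snd.
  exact: continuous_set_val.
- by move=> A; apply: val_inj; rewrite /= mulVKg.
- move=> [x B]; have pE : sphere_proj e0 (s (\val x) * \val B)%g = \val x.
    by rewrite sphere_projM_stab ?sK//; exact: set_valP.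
  by congr pair; apply: val_inj; rewrite /= pE// mulKg.
Qed.

End trivialization.

(** Over the complement of [- b], use the section [rotation_from b]. *)
Lemma sphere_proj_locally_trivial :
  locally_trivial_bundle (orthop_stab e0 : topologicalType) (sphere_proj e0).
Proof.
move=> b; exists [set x | \val x + \val b != 0]; split.
- have /continuousP/(_ [set v | v != 0]) := continuous_addr_point (\val b).
  apply; rewrite (_ : [set v | v != 0] = ~` [set 0]).
    apply: closed_openC; apply: accessible_closed_set1.
    exact: hausdorff_accessible.
  by apply/seteqP; split=> v /= /eqP.
- exact: unit_sphere_addxx.
- exists (trivialization _ _ (rotation_fromK b)); split=> //.
  apply: trivialization_homeomorphism => x; exact: continuous_rotation_from.
Qed.

End evaluation.

Theorem corollary5p11 (R : realType) (H : hilbertType R)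
    (I : Type) (e : I -> H) (he : hilbert_basis e) (i0 : I) :
  let e0 := basis_point he i0 in
  [/\ homeomorphism (orbit_eval e0),
      range (set_val : orthop_stab e0 -> orthop H)
        = sphere_proj e0 @^-1` [set e0] &
      locally_trivial_bundle (orthop_stab e0 : topologicalType)
        (sphere_proj e0)].
Proof.
move=> e0; split.
- exact: orbit_eval_homeomorphism.
- exact: range_orthop_stab.
- exact: sphere_proj_locally_trivial.
Qed.
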